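(* Let $m\ge1$, let $u,v$ be words in $\sigma_1^{\pm1},\dots,\sigma_{m-1}^{\pm1}$, let $1\le i\le m-1$, and let $G_{m,+}$, $G_{m,-}$, $G_{m,0}$ be the braid Gauss diagrams of the words $u\sigma_i v$, $u\sigma_i^{-1}v$, $uv$ respectively (a Conway triple). Then for all integers $k\ge1$, $1\le j\le k$ and $n\ge 0$, $$D_{n,k,j}(G_{m,+})-D_{n,k,j}(G_{m,-})=D_{n-1,k,j}(G_{m,0}),$$ with the convention $D_{-1,k,j}:=0$.
   Context: Braid Gauss diagrams. $B_m$ is the Artin braid group with generators $\sigma_1,\dots,\sigma_{m-1}$. For a word $\beta$ in $\sigma_i^{\pm1}$, the closed braid diagram $D$ of $\beta$ is obtained by joining the top and bottom endpoints of the $m$ strands by $m$ parallel closing strands; it represents an oriented link. The Gauss diagram $G$ of $D$ has one oriented circle parametrizing each component of $D$, and for each crossing an arrow joining its two preimages, pointing from the overpassing preimage to the underpassing one, carrying the sign (local writhe) of the crossing. An arc of $G$ is a connected component of the complement in the circles of all arrow endpoints. The braid Gauss diagram $G_m$ is $G$ together with labels $a_1,\dots,a_m$, where $a_i$ is the arc of $G$ containing the preimage of the $i$-th closing strand. The writhe $w(G_m)$ is the sum of the signs of all arrows. Colored braid Gauss diagrams. For $k\ge1$, a colored braid Gauss diagram associated with $k$ and $G_m$ is $G_m$ together with: base points $*_1,\dots,*_k$ placed on arcs $a_{j_1},\dots,a_{j_k}$ with $1=j_1<j_2<\dots<j_k\le m$ (one base point per arc); and, for each remaining labeled arc $a_j$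 ($j\notin\{j_1,\dots,j_k\}$), a number from $\{1,\dots,l\}$, where $l$ is the largest index with $j_l<j$. $\mathfrak{G}_{k,m}$ denotes the set of all such diagrams (empty if $k>m$). Arrow diagrams. An arrow diagram is a finite collection of oriented circles with finitely many arrows joining pairs of distinct points of the circles, up to orientation-preserving diffeomorphisms of the circles; its arcs are the components of the complement of arrow endpoints. Its surface $\Sigma(A)$ is obtained by gluing an oriented disk to each circle and attaching, for each arrow, an untwisted band (1-handle) with that arrow as core, so that $\Sigma(A)$ is oriented. Each arc of $A$ lies on exactly one boundary component of $\Sigma(A)$. $A$ is multibased with $k$ boundary components if $\Sigma(A)$ has exactly $k$ boundary components and base points $*_1,\dots,*_k$ are placed on arcs lying on $k$ pairwise different boundary components; the one containing $*_i$ is the $i$-th boundary component. Traverse the boundary components in the order $i=1,\dots,k$, each starting from $*_i$ in the boundary orientation (which agrees with the circle orientation along arcs). Each band has two sides parallel to its core arrow; $A$ is descending if for every arrow the first time the traversal runs along a side of its band it runs from the tail end to the head end. $\mathcal{D}_{n,k}$ is the set of descending multibased arrow diagrams with $n$ arrows and $k$ boundary components ($\mathcal{D}_{n,k}=\emptyset$ for $n<0$). Pairing. Let $A$ be multibased with $k$ boundary components and $G\in\mathfrak{G}_{k,m}$. A homomorphism $\phi:A\to G$ is a bijection between the circles of $A$ and those of $G$ together with orientation-preserving homeomorphisms of corresponding circles, mapping each base point $*_i$ of $A$ to the base point $*_i$ of $G$, mapping arrows of $A$ injectively onto arrows of $G$ (tail to tail, head to head), and such that every non-based labeled arc of $G$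 colored by a number $j$ is contained in the image of an arc of $A$ lying on the $j$-th boundary component. Homomorphisms are determined by their image set of arrows (their state). The sign $\varepsilon(\phi)$ is the product of signs of the arrows in the image. $\langle A,G\rangle:=\sum_{\phi}\varepsilon(\phi)$, and $\langle A,G\rangle=0$ if $A$ and $G$ have different numbers of circles. For $1\le j\le k$: $D_{n,k,j}(G_m):=\sum_{G\in\mathfrak{G}_{j,m}}\sum_{A\in\mathcal{D}_{n+j-k,j}}\langle A,G\rangle$. *)

(* Defs.v *)
From HB Require Import structures.
From mathcomp Require Import all_boot all_order all_algebra.
Set Implicit Arguments. Unset Strict Implicit. Unset Printing Implicit Defensive.
Import GRing.Theory Num.Theory.

(* A letter (i, b) is sigma_i if b = true, sigma_i^{-1} if b = false
   (i is 1-based, 1 <= i <= m-1). *)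
Definition letter := (nat * bool)%type.
(* An arrow endpoint: (arrow index, is_head). *)
Definition endpt := (nat * bool)%type.
(* Items on a circle: arrow endpoints (inl) or closing-strand marks (inr q),
   q = 0..m-1 being the 0-based index of the closing strand (a_{q+1}). *)
Definition item := (endpt + nat)%type.
(* Arcs: inl e = the arc starting right after endpoint e (in circle
   orientation); inr c = the whole circle number c (circle w/o endpoints). *)
Definition arc := (endpt + nat)%type.

(* Strand positions are 0-based (0..m-1); sigma_i exchanges positions
   i-1 and i.  Convention: in sigma_i the strand entering at (0-based)
   position i (i.e. the right one) passes over; in sigma_i^{-1} the strand
   entering at position i-1 (the left one) passes over.  Arrows point from
   over to under, so an endpoint is a head iff the strand passes under. *)
Definition step (t p : nat) (l : letter) : seq item * nat :=
  let: (i, b) := l in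
  if p.+1 == i then ([:: inl (t, b)], i)
  else if p == i then ([:: inl (t, ~~ b)], i.-1)
  else ([::], p).

Fixpoint down_from (t : nat) (w : seq letter) (p : nat) : seq item * nat :=
  match w with
  | [::] => ([::], p)
  | l :: w' =>
      let: (s, p') := step t p l in
      let: (s', p'') := down_from t.+1 w' p' in (s ++ s', p'')
  end.

Definition down (w : seq letter) (p : nat) := down_from 0 w p.
Definition bottom (w : seq letter) (p : nat) := (down w p).2.

(* The circle of the closed braid through closing strand q0: the closing
   strand q (mark), then the strand from the top at q down, then the next
   closing strand, ... *)
Fixpoint walk (w : seq letter) (fuel q0 q : nat) : seq item :=
  match fuel with
  | 0 => [::]
  | fuel'.+1 =>
      inr q :: (down w q).1 ++
        (if bottom w q == q0 then [::] else walk w fuel' q0 (bottom w q))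
  end.

Definition is_rep (m : nat) (w : seq letter) (q : nat) :=
  all (fun r => q <= iter r (bottom w) q) (iota 0 m).

(* The (labeled) Gauss diagram of the closure of w on m strands: one circle
   per component, each an oriented cyclic sequence of items; arrow t is the
   t-th crossing with sign sgnl (nth _ w t). *)
Definition gcircs (m : nat) (w : seq letter) : seq (seq item) :=
  [seq walk w m q q | q <- iota 0 m & is_rep m w q].

Definition sgnl (l : letter) : int := if l.2 then 1%R else (-1)%R.

Definition keep (S : pred nat) (x : item) : bool :=
  if x is inl e then S e.1 else true.
Definition restrict (S : pred nat) (cs : seq (seq item)) :=
  [seq filter (keep S) s | s <- cs].

Definition eps (s : seq item) : seq endpt :=
  pmap (fun x : item => if x is inl e then Some e else None) s.

Definition all_arcs (cs : seq (seq item)) : seq arc :=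
  flatten [seq (if eps p.2 is [::] then [:: inr p.1] else map inl (eps p.2))
          | p <- zip (iota 0 (size cs)) cs].

Definition succ_in (es : seq endpt) (e : endpt) : endpt :=
  nth e es ((index e es).+1 %% size es).
Definition csucc (cs : seq (seq item)) (e : endpt) : endpt :=
  foldr (fun s r => if e \in eps s then succ_in (eps s) e else r) e cs.

Definition endp (cs : seq (seq item)) (x : arc) : option endpt :=
  if x is inl e then Some (csucc cs e) else None.

(* Boundary walk of the oriented ribbon surface: run along an arc to its
   final endpoint y, along the side of the band of y from y to the other
   endpoint y' of that arrow, then along the arc starting at y'. *)
Definition nxt (cs : seq (seq item)) (x : arc) : arc :=
  if x is inl e then let y := csucc cs e in inl (y.1, ~~ y.2) else x.

Definition cyc (cs : seq (seq item)) (x : arc) : seq arc :=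
  traject (nxt cs) x
    (index x (traject (nxt cs) (nxt cs x) (size (all_arcs cs)))).+1.

(* canonical representative of the boundary component containing x *)
Definition bcomp (cs : seq (seq item)) (x : arc) : seq arc :=
  [seq y <- all_arcs cs | y \in cyc cs x].

Definition ncomp (cs : seq (seq item)) : nat :=
  size (undup [seq bcomp cs x | x <- all_arcs cs]).

Definition arc_in (c : nat) (s : seq item) (q : nat) : arc :=
  let es := eps s in
  if es is [::] then inr c
  else inl (last (last (0, false) es) (eps (take (index (inr q) s) s))).
Definition arc_of (cs : seq (seq item)) (q : nat) : arc :=
  foldr (fun p r => if inr q \in p.2 then arc_in p.1 p.2 q else r) (inr 0)
        (zip (iota 0 (size cs)) cs).

(* base points *_1..*_k sit on the arcs containing marks bs (in order) *)
Definition multibased (cs : seq (seq item)) (bs : seq nat) : bool :=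
  (ncomp cs == size bs) && uniq [seq bcomp cs (arc_of cs q) | q <- bs].

(* band sides met (as endpoints y, side run from y to its partner) along
   the traversal of the boundary components 1..k from the base points *)
Definition trav (cs : seq (seq item)) (bs : seq nat) : seq endpt :=
  flatten [seq pmap (endp cs) (cyc cs (arc_of cs q)) | q <- bs].

Definition descending (cs : seq (seq item)) (bs : seq nat) : bool :=
  all (fun e : endpt =>
         index (e.1, false) (trav cs bs) < index (e.1, true) (trav cs bs))
      (flatten (map eps cs)).

Definition bases (m : nat) (J : {set 'I_m}) : seq nat := [seq val p | p <- enum J].

(* col p = c (0-based) means arc a_{p+1} is colored c+1; normalized to 0 on
   based arcs.  Condition c+1 <= l, l = #{base j_l < p}. *)
Definition colored (m : nat) (J : {set 'I_m}) (col : {ffun 'I_m -> 'I_m}) : bool :=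
  [exists p in J, val p == 0] &&
  [forall p, if p \in J then val (col p) == 0
             else val (col p) < #|[set r in J | val r < val p]|].

(* the state S (sub-diagram cs = G restricted to S) underlies a homomorphism
   from a descending multibased arrow diagram to the colored diagram (J,col) *)
Definition good_state (m : nat) (cs : seq (seq item)) (J : {set 'I_m})
    (col : {ffun 'I_m -> 'I_m}) : bool :=
  [&& multibased cs (bases J), descending cs (bases J) &
   [forall p, (p \notin J) ==>
      (bcomp cs (arc_of cs (val p)) ==
       bcomp cs (arc_of cs (nth 0 (bases J) (col p))))]].

Definition Spred (L : nat) (S : {set 'I_L}) : pred nat :=
  fun a => a \in [seq val t | t <- enum S].

Local Open Scope ring_scope.

(* D_{n,k,j}(G_m) for the closure of w on m strands; n : int, with
   D_{n,k} empty when the arrow number n+j-k is negative. *)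
Definition Dnkj (n : int) (k j m : nat) (w : seq letter) : int :=
  \sum_(J : {set 'I_m} | #|J| == j)
   \sum_(col : {ffun 'I_m -> 'I_m} | colored J col)
    \sum_(S : {set 'I_(size w)} |
          (#|S|%:Z == n + j%:Z - k%:Z) &&
          good_state (restrict (Spred S) (gcircs m w)) J col)
      \prod_(t in S) sgnl (nth (0%N, true) w t).

(* Main.v *)
(* Gluing a band at a crossing and smoothing that crossing have the same effect
   on the boundary: a boundary component arriving at an endpoint of an arrow
   continues behind the other endpoint, that is, it stays in the same position
   of the braid while the strands cross.  So the boundary components of the
   surface of a state S are the closed strands of the braid word with the
   letters in S smoothed, and the labels a_i lie on them accordingly.  They are
   the same for a state S of the words u sigma_i^{+-1} v that contains the new
   crossing as for S minus this crossing in u v, and so are the conditions on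
   the other arrows.  As the arrows of sigma_i and sigma_i^{-1} have opposite
   directions, S is descending at the new arrow for exactly one of the two
   signs; in both cases its contribution to the difference is the one of S
   minus this crossing.  States without the new crossing cancel. *)

Require Import Defs.
From HB Require Import structures.
From mathcomp Require Import all_boot all_order all_algebra.
From mathcomp Require Import zify.
Import GRing.Theory Num.Theory.

Set Implicit Arguments. Unset Strict Implicit.
Unset Printing Implicit Defensive.

(** * Strands of a partially smoothed braid word *)

(** [step] in two components, so that a letter can be smoothed while its endpoints are still
    recorded. *)
Definition cross (l : letter) (p : nat) : nat :=
  if p.+1 == l.1 then l.1 else if p == l.1 then l.1.-1 else p.
Definition meets (t : nat) (l : letter) (p : nat) : seq endpt :=
  if p.+1 == l.1 then [:: (t, l.2)] else
  if p == l.1 then [:: (t, ~~ l.2)] else [::].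

(* Going down from position [p] before the letter number [t]: the endpoints of
   the arrows in [S] that one meets when the letters in [C] are smoothed. *)
Fixpoint visits (S C : pred nat) (t : nat) (w : seq letter) (p : nat) :
    seq endpt :=
  if w is l :: w' then
    (if S t then meets t l p else [::])
      ++ visits S C t.+1 w' (if C t then p else cross l p)
  else [::].
Fixpoint exit (C : pred nat) (t : nat) (w : seq letter) (p : nat) : nat :=
  if w is l :: w' then exit C t.+1 w' (if C t then p else cross l p) else p.

Definition valid (m : nat) (w : seq letter) : bool :=
  all (fun l : letter => 0 < l.1 < m) w.

Lemma stepE t p l : step t p l = (map inl (meets t l p), cross l p).
Proof. by case: l => i b; rewrite /step /meets /cross /=; do 2?case: ifP. Qed.

Lemma eps_cat s1 s2 : eps (s1 ++ s2) = eps s1 ++ eps s2.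
Proof. by rewrite /eps pmap_cat. Qed.

Lemma down_fromE S t w p :
  filter (keep S) (down_from t w p).1 = map inl (visits S pred0 t w p)
  /\ (down_from t w p).2 = exit pred0 t w p.
Proof.
elim: w t p => [|l w IHw] t p //=.
rewrite stepE; have /= := IHw t.+1 (cross l p).
case: (down_from _ _ _) => s' p' /= [IH1 IH2]; split => //.
rewrite filter_cat map_cat IH1; congr (_ ++ _).
by rewrite /meets; do 2?case: ifP => _ //=; case: ifP.
Qed.

Lemma eps_map_inl s : eps (map inl s) = s.
Proof. by elim: s => //= e s IHs; rewrite -{2}IHs. Qed.

Lemma crossK l : 0 < l.1 -> involutive (cross l).
Proof.
case: l => i b /= i0 p; rewrite /cross /=.
by case: (p.+1 =P i); case: (p =P i); do ?[case: eqP]; lia.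
Qed.

Lemma cross_lt m l p : 0 < l.1 < m -> p < m -> cross l p < m.
Proof. by case: l => i b /=; rewrite /cross /=; do 2?[case: eqP]; lia. Qed.

Lemma perm_cross m l :
  0 < l.1 < m -> perm_eq (map (cross l) (iota 0 m)) (iota 0 m).
Proof.
move=> lm; have l0 : 0 < l.1 by case/andP: lm.
apply: uniq_perm; rewrite ?iota_uniq ?map_inj_uniq ?iota_uniq //.
  exact: inv_inj (crossK l0).
move=> p; rewrite mem_iota /= add0n; apply/mapP/idP.
  by move=> [q]; rewrite mem_iota => qm ->; apply: cross_lt.
by move=> pm; exists (cross l p); rewrite ?crossK // mem_iota cross_lt.
Qed.

(** Each letter acts on the positions as a transposition, or as the identity when smoothed. *)
Lemma perm_exit m C t w : valid m w ->
  perm_eq (map (exit C t w) (iota 0 m)) (iota 0 m).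
Proof.
elim: w t => [|l w IHw] t /=; first by rewrite map_id.
move=> /andP[lm wm]; have IH := IHw t.+1 wm.
case: (C t); first exact: IH.
apply: perm_trans IH.
by rewrite (map_comp (exit C t.+1 w)); apply: perm_map; apply: perm_cross.
Qed.

Lemma perm_flatten_cat (T : eqType) (I : Type) (A B : I -> seq T) s :
  perm_eq (flatten [seq A p ++ B p | p <- s])
          (flatten (map A s) ++ flatten (map B s)).
Proof.
elim: s => //= p s IHs.
by rewrite -!catA perm_cat2l perm_sym perm_catCA perm_cat2l perm_sym.
Qed.

Definition ends (S : pred nat) (t n : nat) : seq endpt :=
  flatten [seq (if S a then [:: (a, false); (a, true)] else [::])
          | a <- iota t n].

Lemma mem_ends S t n (e : endpt) :
  (e \in ends S t n) = S e.1 && (t <= e.1 < t + n).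
Proof.
case: e => a b; apply/flatten_mapP/idP => /=.
  move=> [c]; rewrite mem_iota; case: ifP => // Sc cI.
  by rewrite !inE !xpair_eqE => /orP[] /andP[/eqP -> _]; rewrite Sc.
move=> /andP[Sa aI]; exists a; rewrite ?mem_iota ?Sa //.
by rewrite !inE !xpair_eqE eqxx; case: b.
Qed.

Lemma ends_uniq S t n : uniq (ends S t n).
Proof.
elim: n t => //= n IHn t; rewrite /ends /= cat_uniq.
rewrite -/(ends S t.+1 n) IHn andbT; apply/andP; split.
  by case: ifP => //=; rewrite inE xpair_eqE andbF.
apply/hasPn => -[a b]; rewrite mem_ends /= => /and3P[_ ta _].
by case: ifP => //; rewrite !inE !xpair_eqE; lia.
Qed.

Lemma flatten_meets m t l : 0 < l.1 < m ->
  flatten (map (meets t l) (iota 0 m)) = [:: (t, l.2); (t, ~~ l.2)].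
Proof.
move=> lm.
(* Only the positions [l.1.-1] and [l.1] take part in the crossing; they are split off. *)
have -> : m = l.1.-1 + (2 + (m - l.1.+1)) by lia.
rewrite iotaD map_cat flatten_cat /= add0n.
have far s : all (fun p => (p.+1 != l.1) && (p != l.1)) s ->
    flatten (map (meets t l) s) = [::].
  elim: s => //= p s IHs /andP[/andP[/negbTE p1 /negbTE p2] /IHs ->].
  by rewrite /meets p1 p2.
rewrite !far; last 2 first.
- by apply/allP => p; rewrite mem_iota; lia.
- by apply/allP => p; rewrite mem_iota; lia.
rewrite /meets prednK ?eqxx; last by case/andP: lm.
by rewrite ifF //; apply/eqP; lia.
Qed.

(** Whatever is smoothed, the positions are only permuted, so each letter of [S] is met twice in
    all, once at its tail and once at its head. The uniqueness of endpoints on strands comes from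
    here. *)
Lemma perm_visits m S C t w : valid m w ->
  perm_eq (flatten (map (visits S C t w) (iota 0 m))) (ends S t (size w)).
Proof.
elim: w t => [|l w IHw] t /=; first by elim: (iota 0 m).
move=> /andP[lm wm]; apply: perm_trans (perm_flatten_cat _ _ _) _.
rewrite /ends /=; apply: perm_cat; last first.
  apply: perm_trans (IHw _ wm); case: (C t) => //.
  rewrite (map_comp (visits S C t.+1 w) (cross l)).
  by apply: perm_flatten; apply: perm_map; apply: perm_cross.
case: (S t); last by elim: (iota 0 m).
rewrite flatten_meets //; case: l.2 => //=.
by have /permPl := perm_catC [:: (t, true)] [:: (t, false)].
Qed.

(** * Orbits *)

(** The least positive return time if it is at most [n], and [n.+1] otherwise; [cyc] has its length
    in this form. *)
Definition period (T : eqType) (g : T -> T) (x : T) (n : nat) : nat :=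
  (index x (traject g (g x) n)).+1.

Lemma nth_traject_next (T : Type) (g : T -> T) x n i : i < n ->
  nth x (traject g (g x) n) i = iter i.+1 g x.
Proof.
move=> lt_in; rewrite (set_nth_default (g x)) ?size_traject //.
by rewrite nth_traject // -iterSr.
Qed.

Lemma period_min (T : eqType) (g : T -> T) x n d :
    iter d g x = x -> 0 < d <= n ->
  [/\ period g x n <= d, iter (period g x n) g x = x
    & forall j, 0 < j < period g x n -> iter j g x != x].
Proof.
case: d => // d dx /= dn.
have x_in : x \in traject g (g x) n.
  by apply/trajectP; exists d; rewrite // -iterSr.
have lt_i : index x (traject g (g x) n) < n.
  by rewrite -[X in _ < X](size_traject g (g x)) index_mem.
rewrite /period; set i := index _ _ in lt_i *.
have min_i j : j < i -> iter j.+1 g x != x.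
  move=> lt_j; rewrite -(nth_traject_next g x (ltn_trans lt_j lt_i)).
  by have /= -> := before_find x lt_j.
split.
- by rewrite ltnS leqNgt; apply/negP => /min_i; rewrite dx eqxx.
- by rewrite -[LHS](nth_traject_next g x lt_i) nth_index.
- by case=> // j; apply: min_i.
Qed.

Definition orb (m : nat) (g : nat -> nat) (q : nat) : seq nat :=
  traject g q (period g q m).

Section Orbits.
Variables (m : nat) (g : nat -> nat).
Hypothesis gP : perm_eq (map g (iota 0 m)) (iota 0 m).

Lemma perm_fun_lt p : p < m -> g p < m.
Proof.
move=> pm; have := perm_mem gP (g p); rewrite mem_iota /= add0n => <-.
by rewrite map_f // mem_iota.
Qed.

Lemma perm_fun_inj p q : p < m -> q < m -> g p = g q -> p = q.
Proof.
move=> pm qm; have : uniq (map g (iota 0 m)).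
  by rewrite (perm_uniq gP) iota_uniq.
move=> gU e; apply/eqP; rewrite -(nth_uniq 0 _ _ gU) ?size_map ?size_iota //.
by rewrite !(nth_map 0) ?size_iota // !nth_iota ?add0n ?e.
Qed.

Lemma iter_perm_lt k p : p < m -> iter k g p < m.
Proof. by move=> pm; elim: k => //= k; apply: perm_fun_lt. Qed.

Lemma iter_perm_inj k p q : p < m -> q < m -> iter k g p = iter k g q -> p = q.
Proof.
move=> pm qm; elim: k => //= k IHk /perm_fun_inj e.
by apply: IHk; apply: e; apply: iter_perm_lt.
Qed.

Lemma periodP q : q < m ->
  [/\ period g q m <= m, iter (period g q m) g q = q
    & forall j, 0 < j < period g q m -> iter j g q != q].
Proof.
move=> qm.
(* Pigeonhole: [m.+1] iterates in [m] positions repeat, and injectivity turns the repetition into a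
   return to [q]. *)
have /(uniqPn q) [a [b [ab]]] : ~~ uniq (traject g q m.+1).
  apply/negP => /uniq_leq_size => /(_ (iota 0 m)).
  rewrite size_traject size_iota ltnn => H; apply: (elimF idP erefl).
  by apply: H => _ /trajectP[i _ ->]; rewrite mem_iota iter_perm_lt.
rewrite size_traject => bm.
rewrite !nth_traject ?(ltn_trans ab) // -(subnKC (ltnW ab)) iterD.
move/iter_perm_inj => e; have {e} d1 : iter (b - a) g q = q.
  by rewrite -e // iter_perm_lt.
have [] := @period_min _ g q m _ d1; first by lia.
by move=> le_d p1 p2; split=> //; apply: leq_trans le_d _; lia.
Qed.

Lemma orbP q r : q < m -> reflect (exists k, r = iter k g q) (r \in orb m g q).
Proof.
move=> qm; have [_ dq _] := periodP qm; apply: (iffP idP).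
  by move/trajectP=> [k _ ->]; exists k.
move=> [k ->]; set d := period g q m in dq.
have d0 : 0 < d by [].
rewrite (divn_eq k d) addnC iterD.
have -> : iter (k %/ d * d) g q = q.
  by elim: (k %/ d) => // c IHc; rewrite mulSn iterD IHc.
by apply/trajectP; exists (k %% d); rewrite ?ltn_mod.
Qed.

Lemma mem_orb_id q : q < m -> q \in orb m g q.
Proof. by move=> qm; apply/(orbP _ qm); exists 0. Qed.

Lemma orb_lt q r : q < m -> r \in orb m g q -> r < m.
Proof. by move=> qm /(orbP _ qm)[k ->]; apply: iter_perm_lt. Qed.

Lemma orb_step q r : q < m -> r \in orb m g q -> g r \in orb m g q.
Proof. by move=> qm /(orbP _ qm)[k ->]; apply/(orbP _ qm); exists k.+1. Qed.

Lemma orb_eq q r : q < m -> r \in orb m g q -> orb m g r =i orb m g q.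
Proof.
move=> qm rq s; have rm := orb_lt qm rq; have [_ dq _] := periodP qm.
have /trajectP[k lt_k er] := rq.
apply/(orbP _ rm)/(orbP _ qm) => -[a ->].
  by exists (a + k); rewrite iterD er.
exists (a + (period g q m - k)).
by rewrite er -iterD -addnA subnK ?(ltnW lt_k) // iterD dq.
Qed.

Lemma orb_sym q r : q < m -> r \in orb m g q -> q \in orb m g r.
Proof. by move=> qm rq; rewrite (orb_eq qm rq) mem_orb_id. Qed.

Lemma orb_uniq q : q < m -> uniq (orb m g q).
Proof.
move=> qm; have [_ dq min_d] := periodP qm; apply/negPn/(uniqPn q).
rewrite size_traject => -[a [b [ab bd]]].
rewrite !nth_traject ?(ltn_trans ab) // -(subnKC (ltnW ab)) iterD.
move/iter_perm_inj => e; have := min_d (b - a).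
rewrite -e ?iter_perm_lt // eqxx => H; suff : false by []; apply: H; lia.
Qed.

End Orbits.

Lemma eq_orb m g h q : g =1 h -> orb m g q = orb m h q.
Proof.
move=> gh; have e n x : traject g x n = traject h x n.
  by elim: n x => //= n IHn x; rewrite IHn gh.
by rewrite /orb /period e gh e.
Qed.

(** * The circles of a state *)

Section SubUniq.
Variables (T I : eqType) (F : I -> seq T).

Lemma flatten_sub_uniq s o : uniq (flatten (map F s)) -> uniq s -> uniq o ->
  {subset o <= s} -> uniq (flatten (map F o)).
Proof.
move=> Fs sU oU os.
have /(perm_map F)/perm_flatten/perm_uniq -> : perm_eq o [seq x <- s | x \in o].
  apply: uniq_perm; rewrite ?filter_uniq // => x; rewrite mem_filter.
  by case: (boolP (x \in o)) => // /os ->.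
elim: s Fs {sU os} => //= x s IHs; rewrite cat_uniq.
move=> /and3P[Fx /hasPn disj Fs].
case: ifP => _ /=; last exact: IHs.
rewrite cat_uniq Fx IHs // andbT; apply/hasPn => y /flatten_mapP[z].
rewrite mem_filter => /andP[_ zs] yz; apply: disj.
by apply/flatten_mapP; exists z.
Qed.

Lemma flatten_uniq_inj s x y z : uniq (flatten (map F s)) -> uniq s ->
  x \in s -> y \in s -> z \in F x -> z \in F y -> x = y.
Proof.
move=> Fs sU xs ys zx zy; apply/eqP/negPn/negP => xy.
have := @flatten_sub_uniq s [:: x; y] Fs sU.
rewrite /= inE xy cats0 cat_uniq => H.
have /and3P[_ /hasPn/(_ z zy)/=] :
    [&& uniq (F x), ~~ has [in F x] (F y) & uniq (F y)].
  by apply: H => // t; rewrite !inE => /orP[] /eqP ->.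
by rewrite zx.
Qed.
End SubUniq.

(** * Successors and labeled arcs on circles, chains of arcs *)

Lemma csuccE cs s e : s \in cs -> e \in eps s ->
    (forall s', s' \in cs -> e \in eps s' -> s' = s) ->
  csucc cs e = succ_in (eps s) e.
Proof.
rewrite /csucc; elim: cs => //= s1 cs IHcs; rewrite inE => s_in es uniq_s.
case: ifP => [/uniq_s -> //|]; first by rewrite inE eqxx.
case/orP: s_in => [/eqP <-|s_in _]; first by rewrite es.
by apply: IHcs => // s' s'_in; apply: uniq_s; rewrite inE s'_in orbT.
Qed.

Lemma arc_ofE cs c q : c < size cs -> inr q \in nth [::] cs c ->
    (forall c', c' < size cs -> inr q \in nth [::] cs c' -> c' = c) ->
  arc_of cs q = arc_in c (nth [::] cs c) q.
Proof.
move=> lt_c qc uniq_c; rewrite /arc_of; move: (inr 0) => a0.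
(* The numbering of the circles may start at any [k], as the induction shifts it. *)
rewrite -[c in arc_in c]add0n; move: 0 => k.
elim: cs k c lt_c qc uniq_c => //= s cs IHcs k c lt_c qc uniq_c.
case: ifP => [q_s|q_s]; first by have <- := uniq_c 0 erefl q_s; rewrite addn0.
case: c lt_c qc uniq_c => [|c] /= lt_c qc uniq_c; first by rewrite qc in q_s.
rewrite (IHcs _ c) ?addSnnS // => c' lt_c' qc'.
by apply: succn_inj; apply: uniq_c.
Qed.

(** An arc is named by the endpoint it starts at. Before [y] this is the last entry of [C1] or,
    cyclically, the last entry of the whole list when [C1] is empty. *)
Lemma succ_in_last e0 C1 y C2 : uniq (C1 ++ y :: C2) ->
  succ_in (C1 ++ y :: C2) (last (last e0 (C1 ++ y :: C2)) C1) = y.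
Proof.
case/lastP: C1 => [|C a] U; rewrite /succ_in.
  rewrite cat0s in U *; rewrite -[last _ [::]]/(last y C2) index_last //.
  by rewrite modnn.
rewrite last_rcons cat_rcons index_cat /= eqxx addn0.
move: U; rewrite cat_rcons cat_uniq /= negb_or.
move=> /and3P[_ /andP[/negbTE -> _] _].
rewrite size_cat /= modn_small ?nth_cat; last by rewrite !addnS !ltnS leq_addr.
by rewrite ltnNge leqnSn /= subSnn.
Qed.

(* The arc [x] ends at the first endpoint of [ys]; leaving each endpoint [y]
   of [ys] at [nx y], one meets the next one, and finally gets to [z]. *)
Fixpoint chain (cs : seq (seq item)) (nx : endpt -> endpt) (x : Defs.arc)
    (ys : seq endpt) (z : Defs.arc) : Prop :=
  if ys is y :: ys' then endp cs x = Some y /\ chain cs nx (inl (nx y)) ys' z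
  else x = z.

Lemma chain_cat cs nx x ys z ys' z' :
  chain cs nx x ys z -> chain cs nx z ys' z' -> chain cs nx x (ys ++ ys') z'.
Proof. by elim: ys x => [|y ys IHys] x /= => [->|[-> /IHys]]; auto. Qed.

(** Along a circle one leaves an endpoint where one arrived, whence [nx] is the identity. *)
Lemma chain_circle cs e0 C1 D C2 (es := C1 ++ D ++ C2) :
    uniq es -> {in es, forall e, csucc cs e = succ_in es e} ->
  chain cs id (inl (last (last e0 es) C1)) D
    (inl (last (last e0 es) (C1 ++ D))).
Proof.
elim: D C1 @es => [|y D IHD] C1 es esU succE; first by rewrite cats0.
have es_in : last (last e0 es) C1 \in es.
  case/lastP: C1 @es {esU succE} => [|C a]; first exact: (mem_last y (D ++ C2)).
  by rewrite /= last_rcons mem_cat mem_rcons inE eqxx.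
split=> /=; first by rewrite succE // succ_in_last.
by have := IHD (rcons C1 y); cbv zeta;
  rewrite !cat_rcons last_rcons => /(_ esU succE).
Qed.

(** The other endpoint of the same arrow, where the boundary walk continues. *)
Definition flip (y : endpt) : endpt := (y.1, ~~ y.2).

Lemma flipK : involutive flip.
Proof. by case=> a b; rewrite /flip /= negbK. Qed.

Lemma chain_catP cs nx x ys ys' z : chain cs nx x (ys ++ ys') z ->
  exists2 y, chain cs nx x ys y & chain cs nx y ys' z.
Proof.
elim: ys x => [|y ys IHys] x /=; first by exists x.
by case=> -> /IHys[y' c1 c2]; exists y'.
Qed.

Lemma chain_rcons cs nx x ys y z :
  chain cs nx x (rcons ys y) z -> z = inl (nx y).
Proof. by elim: ys x => [|y' ys IHys] x /= [_ //]; apply: IHys. Qed.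

Section SameKernel.
Variables (I : eqType) (T U : eqType) (h1 : I -> T) (h2 : I -> U) (s : seq I).
Hypothesis h12 : {in s &, forall x y, (h1 x == h1 y) = (h2 x == h2 y)}.

(** Labelings with the same fibres agree on membership, distinctness and number of values; this
    later exchanges boundary components for cycles of positions. *)
Lemma eq_mem_map_kernel x s' : x \in s -> {subset s' <= s} ->
  (h1 x \in map h1 s') = (h2 x \in map h2 s').
Proof.
move=> xs s's; apply/mapP/mapP => -[y ys' /eqP e]; exists y => //;
  by apply/eqP; move: e; rewrite h12 // s's.
Qed.

Lemma eq_uniq_map s' : {subset s' <= s} -> uniq (map h1 s') = uniq (map h2 s').
Proof.
elim: s' => //= x s' IHs s's.
have s's' : {subset s' <= s} by move=> y ys; apply: s's; rewrite inE ys orbT.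
by rewrite IHs // eq_mem_map_kernel // s's // inE eqxx.
Qed.

Lemma eq_size_undup_map : size (undup (map h1 s)) = size (undup (map h2 s)).
Proof.
suff H s' : {subset s' <= s} ->
    size (undup (map h1 s')) = size (undup (map h2 s')) by exact: H.
elim: s' => //= x s' IHs s's.
have s's' : {subset s' <= s} by move=> y ys; apply: s's; rewrite inE ys orbT.
rewrite eq_mem_map_kernel //; last by rewrite s's // inE eqxx.
by case: ifP => _ /=; rewrite IHs.
Qed.
End SameKernel.

(* The hypothesis follows the strands, the conclusion the band sides: on
   meeting a letter of [S], the latter continue on the other strand, hence in
   the same position. *)
Lemma side_chain m cs S t w (A B : nat -> Defs.arc) : valid m w ->
    (forall p, p < m ->
       chain cs id (A p) (visits S pred0 t w p) (B (exit pred0 t w p))) ->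
  forall p, p < m ->
    chain cs flip (A p) (visits S S t w p) (B (exit S t w p)).
Proof.
elim: w t A => [|l w IHw] t A //= /andP[lm wm] H.
have l0 : 0 < l.1 by case/andP: lm.
pose rec p := if S t then meets t l p else [::].
(* The arc in position [p] just below the letter: its strand came in at [cross l p] and may have
   passed an endpoint. *)
pose A' p := last (A (cross l p)) (map inl (rec (cross l p))).
have {}IHw := IHw t.+1 A' wm _; have {IHw}IH p : p < m ->
    chain cs flip (A' p) (visits S S t.+1 w p) (B (exit S t.+1 w p)).
  apply: IHw => {}p pm; have := H _ (cross_lt lm pm).
  rewrite crossK // -/(rec _) /A' => /chain_catP[y + hy].
  move: hy; rewrite /rec /meets; do ![case: ifP => _] => /= hy;
    by [case=> _ -> | move=> ->].
move=> p pm; have := H p pm; rewrite -/(rec p) => /chain_catP[y hy _].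
have := IH p pm; have := IH _ (cross_lt lm pm).
rewrite /A' crossK //; move: hy; rewrite /rec; case: ifP => //= _.
(* At the crossing, the strand from [cross l p] meets the partner of the endpoint met from [p], so
   [A' p] starts where the band side leads. *)
case: (p.+1 =P l.1) => [p1|/eqP/negbTE p1].
  have -> : meets t l p = [:: (t, l.2)] by rewrite /meets p1 eqxx.
  have -> : meets t l (cross l p) = [:: (t, ~~ l.2)].
    by rewrite /cross p1 eqxx /meets eqn_leq ltnn /= eqxx.
  by case=> ex _ _ /=.
case: (p =P l.1) => [p2|/eqP/negbTE p2].
  have -> : meets t l p = [:: (t, ~~ l.2)] by rewrite /meets p1 p2 eqxx.
  have -> : meets t l (cross l p) = [:: (t, l.2)].
    by rewrite /cross p1 p2 eqxx /meets prednK // eqxx.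
  by case=> ex _ _ /=; rewrite /flip /= negbK.
have -> : cross l p = p by rewrite /cross p1 p2.
by rewrite /meets p1 p2.
Qed.

(** A strand meeting no letter of [S] is moved by none of them, so smoothing them does not affect
    it. *)
Lemma visits_nil S t w p : visits S S t w p = [::] ->
  visits S pred0 t w p = [::] /\ exit S t w p = exit pred0 t w p.
Proof.
elim: w t p => //= l w IHw t p; case: (S t) => //=; last exact: IHw.
rewrite /meets /cross; case: ifP => // p1; case: ifP => //= p2; exact: IHw.
Qed.

(** Leaving [y] at [flip y] is one step of [nxt], so a chain spells out the boundary walk and its
    band sides. *)
Lemma chain_iter cs x ys z : chain cs flip x ys z ->
  [/\ iter (size ys) (nxt cs) x = z,
      pmap (endp cs) (traject (nxt cs) x (size ys)) = ys
    & traject (nxt cs) (nxt cs x) (size ys) = map (inl \o flip) ys].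
Proof.
elim: ys x => [|y ys IHys] x //= [ex hy].
have nx : nxt cs x = inl (flip y) by case: x ex => //= e [->].
have [IH1 IH2 IH3] := IHys _ hy.
by rewrite -iterS iterSr nx IH1 IH3 /= ex /= IH2.
Qed.

Lemma mem_all_arcs_inl cs e :
  (inl e \in all_arcs cs) = (e \in flatten (map eps cs)).
Proof.
rewrite /all_arcs; elim: cs 0 => //= s cs IHcs k.
rewrite !mem_cat IHcs; congr (_ || _); case: (eps s) => // e' es.
by rewrite (mem_map (@inl_inj _ _)).
Qed.

Lemma mem_all_arcs_inr cs c :
  (inr c \in all_arcs cs) = (c < size cs) && nilp (eps (nth [::] cs c)).
Proof.
have zipE : zip (iota 0 (size cs)) cs =
    [seq (d, nth [::] cs d) | d <- iota 0 (size cs)].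
  apply: (@eq_from_nth _ (0, [::])) => [|i].
    by rewrite size_zip size_map size_iota minnn.
  rewrite size_zip size_iota minnn => lt_i.
  by rewrite nth_zip ?size_iota // (nth_map 0) ?size_iota // nth_iota.
rewrite /all_arcs zipE -map_comp; apply/flatten_mapP/andP => [[d]|[lt_c c0]].
  rewrite mem_iota /= => lt_d; case d0: (eps _) => [|e es].
    by rewrite inE => /eqP[->]; rewrite d0.
  by case/mapP.
by exists c; rewrite ?mem_iota //= (nilP c0) inE.
Qed.

(** A closed chain without repetition goes round just once: an earlier return to [x] would repeat an
    arc. As its arcs occur in [cs], its length is within the bound used by [cyc]. *)
Lemma cyc_chain cs x ys : chain cs flip x ys x -> ys <> [::] -> uniq ys ->
    {subset map flip ys <= flatten (map eps cs)} ->
  cyc cs x =i map (inl \o flip) ys /\ pmap (endp cs) (cyc cs x) = ys.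
Proof.
move=> hys ysN ysU ys_in; have [it pm tr] := chain_iter hys.
have mU : uniq (map (inl \o flip) ys : seq Defs.arc).
  by rewrite map_inj_uniq //; apply: inj_comp (can_inj flipK); apply: inl_inj.
have [] := period_min (n := size (all_arcs cs)) it.
  rewrite lt0n size_eq0; apply/andP; split; first exact/eqP.
  rewrite -(size_map (inl \o flip : _ -> Defs.arc)); apply: uniq_leq_size => //.
  move=> z /mapP[y y_in ->]; rewrite /= mem_all_arcs_inl; apply: ys_in.
  exact: map_f.
rewrite /cyc /period; move: (index _ _) => d.
case: (ltngtP d.+1 (size ys)) => // [lt_d|->] _ dx _.
  case: (size ys) (size_traject (nxt cs) (nxt cs x) (size ys)) it tr lt_d
    => // n _ it tr lt_d.
  have := nth_uniq x _ _ mU.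
  rewrite -tr size_traject => /(_ d n (ltnW lt_d) (ltnSn n)).
  rewrite !nth_traject_next ?(ltnW lt_d) // dx it eqxx => /esym/eqP d_n.
  by rewrite d_n ltnn in lt_d.
split=> // z; rewrite -tr.
case: (size ys) it => // n it.
by rewrite trajectS trajectSr -iterSr it mem_rcons.
Qed.

(** * Circles of the closed braid, restricted to a state *)

Section Circles.
Variables (m : nat) (w : seq letter) (S : pred nat).
Hypothesis wv : valid m w.
Let f := exit pred0 0 w.
Let E := visits S pred0 0 w.
Let cs := restrict S (gcircs m w).

Let fP : perm_eq (map f (iota 0 m)) (iota 0 m).
Proof. exact: perm_exit. Qed.

Definition circ (o : seq nat) : seq item :=
  flatten [seq inr r :: map inl (visits S pred0 0 w r) | r <- o].

Lemma eps_circ o : eps (circ o) = flatten (map E o).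
Proof.
by elim: o => //= r o IHo; rewrite /circ /= eps_cat eps_map_inl -IHo.
Qed.

Lemma mem_circ o r : (inr r \in circ o) = (r \in o).
Proof.
elim: o => //= q o IHo; rewrite /circ /= !inE mem_cat IHo; congr (_ || _).
by case: mapP => [[]|].
Qed.

Lemma take_circ o1 r o2 : r \notin o1 ->
  take (index (inr r) (circ (o1 ++ r :: o2))) (circ (o1 ++ r :: o2)) = circ o1.
Proof.
rewrite -mem_circ => /negbTE ro1; rewrite {1 2}/circ map_cat flatten_cat.
by rewrite -!/(circ _) index_cat ro1 /= eqxx addn0 take_size_cat.
Qed.

Lemma bottomE q : bottom w q = f q.
Proof. exact: (down_fromE S 0 w q).2. Qed.

Lemma walkE n q0 q d : iter d f q = q0 -> 0 < d <= n ->
    (forall j, 0 < j < d -> iter j f q != q0) ->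
  filter (keep S) (walk w n q0 q) = circ (traject f q d).
Proof.
elim: n q d => [|n IHn] q [|d] //= dq dn min_d; rewrite bottomE.
rewrite /circ /= filter_cat (down_fromE S 0 w q).1; congr (_ :: _ ++ _).
case: d dq dn min_d => [|d] dq dn min_d; first by rewrite dq eqxx.
rewrite (negbTE (min_d 1 _)) //.
by apply: (IHn (f q) d.+1) => [|//|j jd]; rewrite -iterSr //; apply: min_d;
  case/andP: jd.
Qed.

Let reps := [seq q <- iota 0 m | is_rep m w q].

Lemma circlesE : cs = [seq circ (orb m f q) | q <- reps].
Proof.
rewrite /cs /restrict /gcircs -map_comp; apply/eq_in_map => q /=.
rewrite mem_filter mem_iota => /andP[_ qm].
by have [le_d dq min_d] := periodP fP qm; apply: walkE.
Qed.

Lemma reps_lt q : q \in reps -> q < m.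
Proof. by rewrite mem_filter mem_iota => /andP[]. Qed.

(** [is_rep] tests [m] iterates, and no period exceeds [m]. *)
Lemma is_repP q : q \in reps -> forall r, r \in orb m f q -> q <= r.
Proof.
move=> qr r; have qm := reps_lt qr; have [le_d _ _] := periodP fP qm.
move=> /trajectP[k lt_k ->]; move: qr; rewrite mem_filter => /andP[/allP rep _].
rewrite -(eq_iter bottomE); apply: rep; rewrite mem_iota.
exact: leq_trans le_d.
Qed.

Lemma rep_ex r : r < m -> exists2 q, q \in reps & r \in orb m f q.
Proof.
move=> rm; have rr := mem_orb_id fP rm.
have [q qr min_q] := ex_minnP (ex_intro [eta mem (orb m f r)] r rr).
have qm := orb_lt fP rm qr; exists q; last exact: orb_sym.
rewrite mem_filter mem_iota qm /= andbT; apply/allP => k _.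
rewrite (eq_iter bottomE); suff : iter k f q \in orb m f r by exact: min_q.
by rewrite -(orb_eq fP rm qr); apply/(orbP fP _ qm); exists k.
Qed.

Lemma rep_uniq q q' r : q \in reps -> q' \in reps ->
  r \in orb m f q -> r \in orb m f q' -> q = q'.
Proof.
move=> qr q'r rq rq'; have qm := reps_lt qr; have q'm := reps_lt q'r.
by apply/eqP; rewrite eqn_leq !is_repP //;
  [rewrite -(orb_eq fP q'm rq') orb_sym|rewrite -(orb_eq fP qm rq) orb_sym].
Qed.

Lemma visits_inj C r r' e : r < m -> r' < m ->
  e \in visits S C 0 w r -> e \in visits S C 0 w r' -> r = r'.
Proof.
move=> rm r'm; apply: (flatten_uniq_inj (s := iota 0 m));
  rewrite ?iota_uniq ?mem_iota //.
by rewrite (perm_uniq (perm_visits S C 0 wv)) ends_uniq.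
Qed.

Lemma visits_uniq C o : uniq o -> {in o, forall r, r < m} ->
  uniq (flatten (map (visits S C 0 w) o)).
Proof.
move=> oU om; apply: (flatten_sub_uniq (s := iota 0 m));
  rewrite ?iota_uniq // ?(perm_uniq (perm_visits S C 0 wv)) ?ends_uniq // => r.
by rewrite mem_iota => /om.
Qed.

Lemma nth_circles c : c < size reps ->
  nth [::] cs c = circ (orb m f (nth 0 reps c)).
Proof. by move=> lt_c; rewrite circlesE (nth_map 0). Qed.

Lemma arc_of_circ q r : q \in reps -> r \in orb m f q ->
  arc_of cs r = arc_in (index q reps) (circ (orb m f q)) r.
Proof.
move=> qr rq; have lt_i : index q reps < size reps by rewrite index_mem.
have rU : uniq reps by rewrite filter_uniq ?iota_uniq.
rewrite (@arc_ofE _ (index q reps)) ?nth_circles ?nth_index ?mem_circ //.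
  by rewrite circlesE size_map.
move=> c; rewrite {1}circlesE size_map => lt_c.
rewrite nth_circles // mem_circ => rc.
have /eqP := rep_uniq (mem_nth 0 lt_c) qr rc rq.
by rewrite -{1}(nth_index 0 qr) nth_uniq // => /eqP.
Qed.

Lemma csucc_circ q e : q \in reps -> e \in flatten (map E (orb m f q)) ->
  csucc cs e = succ_in (flatten (map E (orb m f q))) e.
Proof.
move=> qr eq; rewrite -eps_circ; apply: csuccE; rewrite ?eps_circ //.
  by rewrite circlesE; apply/mapP; exists q.
move=> s; rewrite circlesE => /mapP[q' q'r ->]; rewrite eps_circ.
move: eq => /flatten_mapP[r rq er] /flatten_mapP[r' rq' er'].
have rr' : r = r'.
  apply: visits_inj er er'; first exact: orb_lt (reps_lt qr) rq.
  exact: orb_lt (reps_lt q'r) rq'.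
by rewrite -rr' in rq'; rewrite (rep_uniq q'r qr rq' rq).
Qed.

Lemma arc_in_circ c o1 r o2 (es := flatten (map E (o1 ++ r :: o2))) :
    r \notin o1 ->
  arc_in c (circ (o1 ++ r :: o2)) r =
  if nilp es then inr c
  else inl (last (last (0, false) es) (flatten (map E o1))).
Proof.
by move=> ro1; rewrite /arc_in take_circ // !eps_circ -/es; case: es.
Qed.

(** The endpoints on the strand [r] form a segment of the cyclic list of its circle, to which
    [chain_circle] applies. This is the input of [side_chain]. *)
Lemma circle_chain r : r < m ->
  chain cs id (arc_of cs r) (E r) (arc_of cs (f r)).
Proof.
move=> rm; have [q qr rq] := rep_ex rm; have qm := reps_lt qr.
have oU := orb_uniq fP qm; have om := @orb_lt _ _ fP q.
have := orb_step fP qm rq.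
set c := index q reps; set es := flatten (map E (orb m f q)) => frq.
have esU : uniq es by apply: visits_uniq => // p; apply: om.
have arcE o1 p o2 : orb m f q = o1 ++ p :: o2 -> arc_of cs p =
    if nilp es then inr c
    else inl (last (last (0, false) es) (flatten (map E o1))).
  move=> ho; rewrite (arc_of_circ qr) ho; last by rewrite mem_cat inE eqxx orbT.
  rewrite arc_in_circ -?ho //; move: oU; rewrite ho cat_uniq /=.
  by rewrite negb_or => /and3P[_ /andP[]].
have succE : {in es, forall e, csucc cs e = succ_in es e}.
  by move=> e; apply: csucc_circ.
have /trajectP[k lt_k rk] := rq.
have := trajectD f k (period f q m - k) q.
rewrite subnKC ?(ltnW lt_k) // -/(orb m f q) -subnSK // -rk trajectS.
case n_eq: (period f q m - k.+1) => [|n] /= ho.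
  (* On the last strand before the return to [q], the segment ends the list and the next arc wraps
     around. *)
  have fr : f r = q.
    have [_ dq _] := periodP fP qm; rewrite -[RHS]dq rk -iterS.
    have -> // : k.+1 = period f q m by lia.
  have esE : es = flatten (map E (traject f q k)) ++ E r.
    by rewrite /es ho map_cat flatten_cat /= cats0.
  rewrite (arcE _ _ _ ho) fr (arcE [::] _ (behead (orb m f q))) //=.
  case: nilP => [es0|esN].
    by move: esE; rewrite es0; case: (E r) => //; case: (flatten _).
  have := @chain_circle cs (0, false) (flatten (map E (traject f q k)))
    (E r) [::].
  rewrite cats0 -esE => /(_ esU succE).
  by case: (es) esN.
have esE : es = flatten (map E (traject f q k)) ++ E r ++
    flatten (map E (traject f (f r) n.+1)).
  by rewrite /es ho map_cat flatten_cat.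
rewrite (arcE _ _ _ ho).
rewrite (arcE (traject f q k ++ [:: r]) _ (traject f (f (f r)) n)); last first.
  by rewrite -catA.
case: nilP => [es0|esN].
  by move: esE; rewrite es0; case: (E r) => //; case: (flatten _).
rewrite map_cat flatten_cat /= cats0 esE; apply: chain_circle; rewrite -esE //.
Qed.

(** ** The boundary components of a state *)

(** [P] follows the strands with [S] smoothed; [loop q] lists the band sides along the closed strand
    through [q]. *)
Let P := exit S 0 w.
Let Y := visits S S 0 w.
Let loop q := flatten (map Y (orb m P q)).

Let PP : perm_eq (map P (iota 0 m)) (iota 0 m).
Proof. exact: perm_exit. Qed.

Lemma visits_exP C e :
  reflect (exists2 r, r < m & e \in visits S C 0 w r) (e \in ends S 0 (size w)).
Proof.
rewrite -(perm_mem (perm_visits S C 0 wv)); apply: (iffP flatten_mapP) => -[r].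
  by rewrite mem_iota => rm er; exists r.
by move=> rm er; exists r; rewrite ?mem_iota.
Qed.

Lemma mem_ends_flip e n : (flip e \in ends S 0 n) = (e \in ends S 0 n).
Proof. by rewrite !mem_ends. Qed.

Lemma mem_circles_ends e :
  (e \in flatten (map eps cs)) = (e \in ends S 0 (size w)).
Proof.
apply/flatten_mapP/(visits_exP pred0) => [[s]|[r rm er]].
  rewrite circlesE => /mapP[q qr ->]; rewrite eps_circ.
  move=> /flatten_mapP[r rq er].
  by exists r => //; apply: orb_lt (reps_lt qr) rq.
have [q qr rq] := rep_ex rm; exists (circ (orb m f q)).
  by rewrite circlesE; apply/mapP; exists q.
by rewrite eps_circ; apply/flatten_mapP; exists r.
Qed.

Lemma traject_chain k q : q < m ->
  chain cs flip (arc_of cs q) (flatten (map Y (traject P q k)))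
    (arc_of cs (iter k P q)).
Proof.
elim: k q => //= k IHk q qm; rewrite -iterS iterSr.
apply: chain_cat (IHk _ (perm_fun_lt PP qm)).
exact: (side_chain (B := arc_of cs)) wv circle_chain q qm.
Qed.

Lemma loop_chain q : q < m ->
  chain cs flip (arc_of cs q) (loop q) (arc_of cs q).
Proof.
move=> qm; have [_ dq _] := periodP PP qm.
by rewrite -{3}dq; apply: traject_chain.
Qed.

Lemma loop_uniq q : q < m -> uniq (loop q).
Proof.
by move=> qm; apply: visits_uniq (orb_uniq PP qm) _ => r; apply: orb_lt.
Qed.

Lemma loop_ends q : q < m -> {subset loop q <= ends S 0 (size w)}.
Proof.
move=> qm e /flatten_mapP[r rq er]; apply/(visits_exP S); exists r => //.
exact: orb_lt rq.
Qed.

Lemma mem_loop_eq p q e e' : p < m -> q < m -> e \in loop p -> e' \in loop q ->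
  e = e' -> p \in orb m P q.
Proof.
move=> pm qm /flatten_mapP[r rp er] /flatten_mapP[r' rq er'] ee'.
have rr' : r = r'.
  rewrite -ee' in er'.
  exact: visits_inj (orb_lt PP pm rp) (orb_lt PP qm rq) er er'.
by rewrite -(orb_eq PP qm rq) -rr' (orb_eq PP pm rp) mem_orb_id.
Qed.

Lemma cyc_loop q : q < m -> loop q <> [::] ->
  cyc cs (arc_of cs q) =i map (inl \o flip) (loop q)
  /\ pmap (endp cs) (cyc cs (arc_of cs q)) = loop q.
Proof.
move=> qm qN; apply: cyc_chain => //; [exact: loop_chain|exact: loop_uniq|].
move=> e /mapP[y /loop_ends yq ->].
by rewrite mem_circles_ends mem_ends_flip yq.
Qed.

(** A boundary component running along no band is a whole circle, as smoothing does not affect its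
    strands. *)
Lemma loop_nil q : q < m -> loop q = [::] ->
  orb m P q =i orb m f q /\ {in orb m f q, forall r, E r = [::]}.
Proof.
move=> qm q0.
have nil r : r \in orb m P q -> E r = [::] /\ P r = f r.
  move=> rq; apply: visits_nil; case Yr: (visits S S 0 w r) => [//|e es].
  suff: e \in loop q by rewrite q0.
  by apply/flatten_mapP; exists r; rewrite // /Y Yr inE eqxx.
have iterE k : iter k P q = iter k f q.
  elim: k => //= k <-; apply: (nil _ _).2.
  by apply/(orbP PP _ qm); exists k.
have mem_o : orb m P q =i orb m f q.
  by move=> r; apply/(orbP PP _ qm)/(orbP fP _ qm) => -[k ->]; exists k.
by split=> // r; rewrite -mem_o => /nil[].
Qed.

Lemma arc_of_nil q : q < m -> loop q = [::] ->
  exists q0, [/\ q0 \in reps, q \in orb m f q0,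
    arc_of cs q = inr (index q0 reps) & arc_of cs q \in all_arcs cs].
Proof.
move=> qm /(loop_nil qm)[_ Eq].
have [q0 q0r qq0] := rep_ex qm; exists q0.
have Eq0 : eps (circ (orb m f q0)) = [::].
  rewrite eps_circ; case Eq0: (flatten _) => [//|e es].
  have : e \in flatten (map E (orb m f q0)) by rewrite Eq0 inE eqxx.
  move=> /flatten_mapP[r]; rewrite -(orb_eq fP (reps_lt q0r) qq0).
  by move=> /Eq ->.
have -> : arc_of cs q = inr (index q0 reps).
  by rewrite (arc_of_circ q0r qq0) /arc_in Eq0.
split=> //; rewrite mem_all_arcs_inr circlesE size_map index_mem q0r -circlesE.
by rewrite nth_circles ?index_mem // nth_index // Eq0.
Qed.

(** The loop closes up at the arc of [q], which therefore starts at the partner of its last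
    entry. *)
Lemma arc_of_loop q : q < m -> loop q <> [::] ->
  exists2 y, y \in loop q & arc_of cs q = inl (flip y).
Proof.
move=> qm qN; have [+ _ _] := chain_iter (loop_chain qm).
have [_ _] := chain_iter (loop_chain qm).
case: (lastP (loop q)) qN => // ys y _.
rewrite size_rcons trajectSr map_rcons => /rcons_inj[_ e].
rewrite iterSr e => <-; exists y => //; by rewrite mem_rcons inE eqxx.
Qed.

Lemma cyc_nil q : q < m -> loop q = [::] ->
  cyc cs (arc_of cs q) = [:: arc_of cs q].
Proof.
move=> qm /(arc_of_nil qm)[q0 [_ _ ->]]; rewrite /cyc /=.
by case: (size _) => //= n; rewrite eqxx.
Qed.

Lemma trav_loop q : q < m -> pmap (endp cs) (cyc cs (arc_of cs q)) = loop q.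
Proof.
move=> qm; case: (altP (loop q =P [::])) => [q0|/eqP qN].
  by rewrite cyc_nil // q0; have [q' [_ _ ->]] := arc_of_nil qm q0.
by have [] := cyc_loop qm qN.
Qed.

Lemma arc_of_mem q : q < m -> arc_of cs q \in all_arcs cs.
Proof.
move=> qm; case: (altP (loop q =P [::])) => [q0|/eqP qN]; last first.
  have [y yq ->] := arc_of_loop qm qN.
  by rewrite mem_all_arcs_inl mem_circles_ends mem_ends_flip (loop_ends qm).
by have [q' [_ _ _]] := arc_of_nil qm q0.
Qed.

Lemma loop_eq p q : q < m -> p \in orb m P q -> loop p =i loop q.
Proof.
move=> qm pq e; apply/flatten_mapP/flatten_mapP => -[r rp er]; exists r => //.
  by rewrite -(orb_eq PP qm pq).
by rewrite (orb_eq PP qm pq).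
Qed.

Lemma cyc_eq p q : q < m -> p \in orb m P q ->
  cyc cs (arc_of cs p) =i cyc cs (arc_of cs q).
Proof.
move=> qm pq; have pm := orb_lt PP qm pq; have pq_loop := loop_eq qm pq.
case: (altP (loop q =P [::])) => [q0|/eqP qN].
  suff -> : arc_of cs p = arc_of cs q by [].
  have /trajectP[k lt_k ->] := pq; have := traject_chain k qm.
  case Yk: (flatten _) => [//|e es]; suff: e \in loop q by rewrite q0.
  have : e \in flatten (map Y (traject P q k)) by rewrite Yk inE eqxx.
  move=> /flatten_mapP[r /trajectP[i _ ->] er]; apply/flatten_mapP.
  by exists (iter i P q) => //; apply/(orbP PP _ qm); exists i.
have pN : loop p <> [::].
  move=> p0; case: (loop q) pq_loop qN => // e es /(_ e).
  by rewrite p0 !inE eqxx.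
by move=> x; rewrite (cyc_loop pm pN).1 (cyc_loop qm qN).1; apply: eq_mem_map.
Qed.

(** An arc on the component of [q] starts at the partner of an entry of [loop q], and this entry
    determines the cycle. If the loop is empty, the number of the circle determines it. *)
Lemma bcomp_eq p q : p < m -> q < m ->
  (bcomp cs (arc_of cs p) == bcomp cs (arc_of cs q)) = (p \in orb m P q).
Proof.
move=> pm qm; apply/eqP/idP => [pq|pq]; last first.
  by apply: eq_in_filter => x _; apply: cyc_eq.
have : arc_of cs p \in bcomp cs (arc_of cs q).
  by rewrite -pq mem_filter arc_of_mem // andbT /cyc trajectS inE eqxx.
rewrite mem_filter => /andP[+ _].
case: (altP (loop q =P [::])) => [q0|/eqP qN].
  rewrite cyc_nil // inE => /eqP apq.
  case: (altP (loop p =P [::])) => [p0|/eqP pN]; last first.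
    have [y _ apy] := arc_of_loop pm pN.
    have [q' [_ _ aq _]] := arc_of_nil qm q0.
    by move: apq; rewrite apy aq.
  have [p' [p'r pp' ap _]] := arc_of_nil pm p0.
  have [q' [q'r qq' aq _]] := arc_of_nil qm q0.
  move: apq; rewrite ap aq => -[] /(congr1 (nth 0 reps)).
  rewrite !nth_index // => p'q'; rewrite p'q' in pp'.
  rewrite (loop_nil qm q0).1 (orb_eq fP (reps_lt q'r) qq') //.
rewrite (cyc_loop qm qN).1 => /mapP[y yq apy].
case: (altP (loop p =P [::])) => [p0|/eqP pN].
  by have [p' [_ _ ap _]] := arc_of_nil pm p0; rewrite ap in apy.
have [y' yp ap] := arc_of_loop pm pN; rewrite ap in apy.
apply: mem_loop_eq yp yq _ => //.
exact: inv_inj flipK _ _ (@inl_inj endpt nat _ _ apy).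
Qed.

(** Every endpoint is met on a closed strand, which passes a labeled arc; a circle without endpoints
    carries the mark of its representative. *)
Lemma bcomp_arc_of x : x \in all_arcs cs ->
  exists2 q, q < m & bcomp cs x = bcomp cs (arc_of cs q).
Proof.
case: x => [e|c].
  rewrite mem_all_arcs_inl mem_circles_ends -mem_ends_flip.
  move=> /(visits_exP S)[q qm eq]; exists q => //.
  apply: eq_in_filter => z _.
  have yq : flip e \in loop q.
    by apply/flatten_mapP; exists q; rewrite ?mem_orb_id.
  have qN : loop q <> [::] by case: (loop q) yq.
  rewrite (cyc_loop qm qN).1.
  (* The closed chain is cut after [flip e] and rotated so as to start at the arc [inl e]. *)
  have [ys1 [ys2 qE]] : exists ys1 ys2, loop q = rcons ys1 (flip e) ++ ys2.
    by case/path.splitP: yq => ys1 ys2; exists ys1, ys2.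
  have perm_q : perm_eq (ys2 ++ rcons ys1 (flip e)) (loop q).
    by rewrite qE; apply/permPl/perm_catC.
  have := loop_chain qm; rewrite qE => /chain_catP[y h1 h2].
  have ye := chain_rcons h1; rewrite flipK in ye; rewrite ye in h1 h2.
  have [||| -> _] := cyc_chain (chain_cat h2 h1).
  - by case: (ys2) => [|//]; case: (ys1).
  - by rewrite (perm_uniq perm_q) loop_uniq.
  - move=> e' /mapP[y' + ->]; rewrite (perm_mem perm_q) => y'q.
    by rewrite mem_circles_ends mem_ends_flip (loop_ends qm).
  by rewrite -qE; apply/perm_mem/perm_map.
rewrite mem_all_arcs_inr => /andP[lt_c c0].
have cr : c < size reps by rewrite circlesE size_map in lt_c.
rewrite nth_circles // in c0; set q := nth 0 reps c in c0.
have qr : q \in reps by apply: mem_nth.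
have qm := reps_lt qr; exists q => //; congr (bcomp cs _).
rewrite (arc_of_circ qr) ?mem_orb_id // /arc_in (nilP c0).
by rewrite index_uniq // filter_uniq ?iota_uniq.
Qed.

(** Increasing order makes equal cycles equal lists, as for [bcomp]. *)
Definition comp m (g : nat -> nat) q := [seq r <- iota 0 m | r \in orb m g q].

Lemma comp_eq g p q : perm_eq (map g (iota 0 m)) (iota 0 m) -> p < m -> q < m ->
  (comp m g p == comp m g q) = (p \in orb m g q).
Proof.
move=> gP pm qm; apply/eqP/idP => [pq|pq]; last first.
  by apply: eq_in_filter => x _; apply: orb_eq.
have : p \in comp m g p by rewrite mem_filter mem_orb_id ?mem_iota.
by rewrite pq mem_filter => /andP[].
Qed.

Lemma ncompE : ncomp cs = size (undup (map (comp m P) (iota 0 m))).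
Proof.
transitivity (size (undup [seq bcomp cs (arc_of cs q) | q <- iota 0 m])).
  apply/perm_size/uniq_perm; rewrite ?undup_uniq // => x; rewrite !mem_undup.
  apply/mapP/mapP => -[y y_in ->].
    by have [q qm ->] := bcomp_arc_of y_in; exists q; rewrite ?mem_iota.
  by exists (arc_of cs y) => //; apply: arc_of_mem; rewrite mem_iota in y_in.
apply: eq_size_undup_map => p q; rewrite !mem_iota => pm qm.
by rewrite bcomp_eq // comp_eq.
Qed.

End Circles.

(** * Inserting a crossing *)

Definition tour m (g : nat -> nat) (Y : nat -> seq endpt) (bs : seq nat) :=
  flatten [seq flatten (map Y (orb m g q)) | q <- bs].

(** The conditions of [good_state] that concern only the components and their labels, hence only the
    permutation [g]. *)
Definition components_ok m (g : nat -> nat) (J : {set 'I_m})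
    (col : {ffun 'I_m -> 'I_m}) : bool :=
  [&& size (undup (map (comp m g) (iota 0 m))) == size (bases J),
      uniq (map (comp m g) (bases J)) &
      [forall p, (p \notin J) ==>
         (val p \in orb m g (nth 0 (bases J) (col p)))]].

Lemma bases_lt m (J : {set 'I_m}) q : q \in bases J -> q < m.
Proof. by case/mapP=> p _ ->; apply: ltn_ord. Qed.

(** Each condition on the surface becomes one on the smoothed word, by [ncompE], [bcomp_eq] and
    [trav_loop]. *)
Lemma good_stateE m w S (J : {set 'I_m}) col : valid m w ->
  good_state (restrict S (gcircs m w)) J col =
  components_ok (exit S 0 w) J col &&
  all (fun a => S a ==>
         let tr := tour m (exit S 0 w) (visits S S 0 w) (bases J) in
         index (a, false) tr < index (a, true) tr) (iota 0 (size w)).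
Proof.
move=> wv; rewrite /good_state /components_ok /multibased (ncompE S wv).
rewrite -!andbA; congr (_ && _).
have -> : uniq [seq bcomp (restrict S (gcircs m w))
             (arc_of (restrict S (gcircs m w)) q) | q <- bases J] =
          uniq (map (comp m (exit S 0 w)) (bases J)).
  apply: (eq_uniq_map (s := iota 0 m)) => [p q|q /bases_lt].
    rewrite !mem_iota => pm qm.
    rewrite bcomp_eq // comp_eq //. exact: perm_exit.
  by rewrite mem_iota.
congr (_ && _); rewrite andbC; congr (_ && _).
  apply: eq_forallb => p; congr (_ ==> _).
  apply: bcomp_eq => //; first exact: ltn_ord.
  have [lt_c|ge_c] := ltnP (col p) (size (bases J)).
    exact: bases_lt (mem_nth 0 lt_c).
  (* A color beyond the base points gives the default [0], which is a position too. *)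
  by rewrite nth_default //; apply: leq_ltn_trans (ltn_ord p).
rewrite /descending.
have -> : trav (restrict S (gcircs m w)) (bases J) =
    tour m (exit S 0 w) (visits S S 0 w) (bases J).
  rewrite /trav /tour; congr flatten; apply/eq_in_map => q /bases_lt qm.
  exact: trav_loop.
rewrite (eq_all_r (mem_circles_ends S wv)).
apply/allP/allP => /= [H a|H e].
  rewrite mem_iota => aw; apply/implyP => Sa.
  by apply: (H (a, false)); rewrite mem_ends /= Sa.
rewrite mem_ends => /andP[Se ew].
by apply: (implyP (H e.1 _)); rewrite ?mem_iota.
Qed.

Lemma eq_components_ok m g h (J : {set 'I_m}) col : g =1 h ->
  components_ok g J col = components_ok h J col.
Proof.
move=> gh; rewrite /components_ok.
have gh_comp : comp m g =1 comp m h.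
  by move=> q; apply: eq_filter => r; rewrite (eq_orb m q gh).
rewrite !(eq_map gh_comp); congr [&& _, _ & _].
by apply: eq_forallb => p; rewrite (eq_orb _ _ gh).
Qed.

(** There are as many base points as cycles, and they lie on different cycles, so each cycle is
    traversed. *)
Lemma tour_cover m g Y (J : {set 'I_m}) col r e :
    perm_eq (map g (iota 0 m)) (iota 0 m) -> components_ok g J col ->
  r < m -> e \in Y r -> e \in tour m g Y (bases J).
Proof.
move=> gP /and3P[/eqP szJ uJ _] rm er.
have sub : {subset map (comp m g) (bases J) <=
              undup (map (comp m g) (iota 0 m))}.
  move=> _ /mapP[q qJ ->]; rewrite mem_undup map_f // mem_iota.
  exact: bases_lt qJ.
have [|_ eqi] := uniq_min_size uJ sub; first by rewrite szJ [leqRHS]size_map.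
have : comp m g r \in map (comp m g) (bases J).
  by rewrite eqi mem_undup map_f // mem_iota.
case/mapP => q qJ /eqP; rewrite comp_eq ?(bases_lt qJ) // => rq.
by apply/flatten_mapP; exists q => //; apply/flatten_mapP; exists r.
Qed.

(** * Words with one inserted letter *)

Lemma visits_cat S C t w1 w2 p : visits S C t (w1 ++ w2) p =
  visits S C t w1 p ++ visits S C (t + size w1) w2 (exit C t w1 p).
Proof.
elim: w1 t p => [|l w1 IHw1] t p /=; first by rewrite addn0.
by rewrite IHw1 -catA addSnnS.
Qed.

Lemma exit_cat C t w1 w2 p :
  exit C t (w1 ++ w2) p = exit C (t + size w1) w2 (exit C t w1 p).
Proof.
by elim: w1 t p => [|l w1 IHw1] t p /=; [rewrite addn0|rewrite IHw1 addSnnS].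
Qed.

Lemma visits_map (h : nat -> nat) (S S' : pred nat) t t' w p :
    (forall a, a < size w -> h (t + a) = t' + a /\ S' (t + a) = S (t' + a)) ->
  visits S S t' w p = [seq (h e.1, e.2) | e <- visits S' S' t w p]
  /\ exit S t' w p = exit S' t w p.
Proof.
elim: w t t' p => //= l w IHw t t' p H.
have [] := H 0 isT; rewrite !addn0 => ht St.
have IH := IHw t.+1 t'.+1; rewrite St.
have [|-> ->] := IH (if S t' then p else cross l p).
  by move=> a aw; rewrite !addSnnS; apply: H.
split=> //; rewrite map_cat; congr (_ ++ _); case: (S t') => //.
by rewrite /meets; do ![case: ifP => _ //=]; rewrite ht.
Qed.

Lemma index_filter_lt (T : eqType) (a : pred T) (s : seq T) x y : a x -> a y ->
  (index x (filter a s) < index y (filter a s)) = (index x s < index y s).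
Proof.
move=> ax ay; elim: s => //= z s IHs; case: ifP => az /=.
  by do 2?case: eqP => _ //.
have -> : z == x = false by apply: contraFF az => /eqP ->.
by have -> : z == y = false by apply: contraFF az => /eqP ->.
Qed.

Section OneLetter.
Variables (m : nat) (u v : seq letter) (i : nat) (S : pred nat).
Hypothesis uv : valid m (u ++ v).
Hypothesis im : 0 < i < m.
Let word b := u ++ (i, b) :: v.
Let t0 := size u.

Lemma valid_word b : valid m (word b).
Proof. by move: uv; rewrite /valid !all_cat /= im. Qed.

Lemma size_word b : size (word b) = (size (u ++ v)).+1.
Proof. by rewrite !size_cat addnS. Qed.

(** The sign of a letter enters only through the direction of its arrow, which is absent here. *)
Lemma good_state_notin (J : {set 'I_m}) col : ~~ S t0 ->
  good_state (restrict S (gcircs m (word true))) J col =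
  good_state (restrict S (gcircs m (word false))) J col.
Proof.
move=> /negbTE St0; rewrite !good_stateE ?valid_word //.
have ex : exit S 0 (word true) =1 exit S 0 (word false).
  by move=> p; rewrite !exit_cat /= add0n -/t0 St0.
have vi : visits S S 0 (word true) =1 visits S S 0 (word false).
  by move=> p; rewrite !visits_cat /= add0n -/t0 St0.
rewrite (eq_components_ok _ _ ex) !size_word.
rewrite /tour (eq_map (g := fun q => flatten
  (map (visits S S 0 (word false)) (orb m (exit S 0 (word false)) q)))) //.
by move=> q; rewrite (eq_orb _ _ ex) (eq_map vi).
Qed.

Variable S' : pred nat.
Hypothesis St0 : S t0.
(** [S'] is [S] without the new letter, renumbered: [bump t0] skips [t0]. *)
Hypothesis SS' : forall a, S' a = S (bump t0 a).
Let w0 := u ++ v.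
Let bumpe (e : endpt) : endpt := (bump t0 e.1, e.2).

(** A smoothed letter keeps all positions, like an absent one, and adds only its own endpoints; a
    change of sign exchanges these. *)
Lemma visits_word b p :
  [/\ exit S 0 (word b) p = exit S' 0 w0 p,
      [seq e <- visits S S 0 (word b) p | e.1 != t0]
        = map bumpe (visits S' S' 0 w0 p)
    & visits S S 0 (word (~~ b)) p =
        [seq (if e.1 == t0 then flip e else e) | e <- visits S S 0 (word b) p]].
Proof.
have [a lt_a|vu xu] := @visits_map (bump t0) S S' 0 0 u p.
  by rewrite !add0n SS' /bump leqNgt lt_a add0n.
rewrite !visits_cat !exit_cat !add0n /= -/t0 St0 vu xu.
move: (exit S' 0 u p) (visits S' S' 0 u p) => {vu xu}p su.
have [a lt_a|-> ->] := @visits_map (bump t0) S S' t0 t0.+1 v p.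
  by rewrite SS' /bump leq_addr addSn add1n.
have keep_bump s : [seq e <- map bumpe s | e.1 != t0] = map bumpe s.
  by apply/all_filterP/allP => e /mapP[e' _ ->] /=; rewrite eq_sym neq_bump.
have flip_bump s : map bumpe s =
    [seq (if e.1 == t0 then flip e else e) | e <- map bumpe s].
  rewrite -map_comp; apply: eq_map => e /=.
  by rewrite eq_sym (negbTE (neq_bump _ _)).
split=> //.
  rewrite !filter_cat !keep_bump map_cat /meets; congr (_ ++ _).
  by case: (_ == _); [|case: (_ == _)]; rewrite /= ?eqxx.
rewrite !map_cat -!flip_bump; congr (_ ++ (_ ++ _)).
by rewrite /meets; case: (_ == _); [|case: (_ == _)]; rewrite /= ?eqxx.
Qed.

Lemma exit_word b : exit S 0 (word b) =1 exit S' 0 w0.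
Proof. by move=> p; have [] := visits_word b p. Qed.

Section Tours.
Variable bs : seq nat.
Let tr b := tour m (exit S 0 (word b)) (visits S S 0 (word b)) bs.

Lemma tour_word b : [seq e <- tr b | e.1 != t0] =
  map bumpe (tour m (exit S' 0 w0) (visits S' S' 0 w0) bs).
Proof.
rewrite /tr /tour filter_flatten map_flatten -!map_comp; congr flatten.
apply: eq_map => q; rewrite [LHS]filter_flatten [RHS]map_flatten -!map_comp.
rewrite (eq_orb _ _ (exit_word b)); congr flatten; apply: eq_map => r /=.
by have [] := visits_word b r.
Qed.

Lemma tour_word_neg : tr false =
  [seq (if e.1 == t0 then flip e else e) | e <- tr true].
Proof.
rewrite /tr /tour map_flatten -!map_comp; congr flatten.
apply: eq_map => q; rewrite [RHS]map_flatten -!map_comp.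
rewrite !(eq_orb _ _ (exit_word _)); congr flatten; apply: eq_map => r /=.
by have [] := visits_word true r.
Qed.

Lemma index_tour_neg b : index (t0, b) (tr false) = index (t0, ~~ b) (tr true).
Proof.
rewrite tour_word_neg.
set g := fun e : endpt => if e.1 == t0 then flip e else e.
have gK : involutive g.
  move=> [a c]; rewrite /g /=; case: (eqVneq a t0) => [->|/negbTE a0] /=.
    by rewrite eqxx flipK.
  by rewrite a0.
have -> : (t0, b) = g (t0, ~~ b) by rewrite /g eqxx /flip /= negbK.
by rewrite index_map //; apply: inv_inj.
Qed.
End Tours.

(** Deleting the endpoints of the new arrow preserves the order of the others, so only the condition
    at the new arrow is added. *)
Lemma good_state_in b (J : {set 'I_m}) col :
  good_state (restrict S (gcircs m (word b))) J col =
  good_state (restrict S' (gcircs m w0)) J col &&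
  let tr := tour m (exit S 0 (word b)) (visits S S 0 (word b)) (bases J) in
  index (t0, false) tr < index (t0, true) tr.
Proof.
rewrite !good_stateE ?valid_word // (eq_components_ok _ _ (exit_word b)).
rewrite -andbA; congr (_ && _) => /=.
set tr := tour _ (exit S _ _) _ _; set tr' := tour _ _ _ _.
have index_bump a c : index (bump t0 a, c) [seq e <- tr | e.1 != t0] =
    index (a, c) tr'.
  rewrite tour_word -[(bump t0 a, c)]/(bumpe (a, c)) index_map //.
  by move=> [a1 c1] [a2 c2] [/(can_inj (bumpK t0)) -> ->].
have lt_bump a : (index (a, false) tr' < index (a, true) tr') =
    (index (bump t0 a, false) tr < index (bump t0 a, true) tr).
  by rewrite -!index_bump index_filter_lt //= eq_sym neq_bump.
apply/allP/andP => [H|[/allP H Ht0] a].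
  split; last first.
    apply: (implyP (H t0 _)) => //.
    by rewrite mem_iota size_word /t0 size_cat; lia.
  apply/allP => a; rewrite mem_iota => lt_a; rewrite SS' lt_bump; apply: H.
  rewrite mem_iota size_word /bump; move: lt_a; rewrite /w0.
  by case: (t0 <= a); lia.
rewrite mem_iota size_word => lt_a; have [->|at0] := eqVneq a t0.
  by rewrite St0.
have := H (unbump t0 a); rewrite SS' lt_bump unbumpK ?inE //; apply.
by move: at0 lt_a; rewrite mem_iota /unbump /t0 !size_cat; lia.
Qed.

(** The two signs traverse the endpoints of the new arrow in opposite orders. The sum of truth
    values encodes that exactly one sign is good if the smaller state is, and none otherwise. *)
Lemma good_state_split (J : {set 'I_m}) col :
  (good_state (restrict S (gcircs m (word true))) J col +
   good_state (restrict S (gcircs m (word false))) J col)%N =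
  good_state (restrict S' (gcircs m w0)) J col.
Proof.
rewrite !good_state_in; case: (boolP (good_state _ _ _)) => //=.
rewrite good_stateE // => /andP[okJ _].
set tr := tour _ _ _ _; rewrite !index_tour_neg -/tr /=.
have [r rm t0r] : exists2 r, r < m & (t0, true) \in visits S S 0 (word true) r.
  apply/visits_exP; first exact: valid_word.
  by rewrite mem_ends St0 size_word size_cat /t0 /=; lia.
have t0_in : (t0, true) \in tr.
  apply: (tour_cover (col := col)) rm t0r; first exact/perm_exit/valid_word.
  by rewrite (eq_components_ok _ _ (exit_word true)) okJ.
(* As the traversal reaches the head, equal indices would identify head and tail. *)
case: ltngtP => // same.
have : (t0, false) \in tr by rewrite -index_mem same index_mem.
by move=> /(nth_index (0, true)); rewrite same nth_index.
Qed.
End OneLetter.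

(** * Sums over the states containing a given letter *)

Local Open Scope ring_scope.

Lemma mem_Spred L (S : {set 'I_L}) (t : 'I_L) : Spred S t = (t \in S).
Proof. by rewrite /Spred (mem_map val_inj) mem_enum. Qed.

Lemma Spred_ge L (S : {set 'I_L}) a : (L <= a)%N -> Spred S a = false.
Proof.
move=> La; apply/negbTE/mapP => -[t _ e]; move: La.
by rewrite e leqNgt ltn_ord.
Qed.

(** Lets the words of both signs sum over sets of the same type. *)
Lemma Dnkj_size L n k j m w : size w = L ->
  Dnkj n k j m w =
  \sum_(J : {set 'I_m} | #|J| == j)
   \sum_(col : {ffun 'I_m -> 'I_m} | colored J col)
    \sum_(S : {set 'I_L} |
          (#|S|%:Z == n + j%:Z - k%:Z) &&
          good_state (restrict (Spred S) (gcircs m w)) J col)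
      \prod_(t in S) sgnl (nth (0%N, true) w t).
Proof. by move=> <-. Qed.

Section AddElement.
Variables (L : nat) (t0 : 'I_L.+1).

Definition add_lift (S : {set 'I_L}) : {set 'I_L.+1} := t0 |: lift t0 @: S.

Lemma notin_lift (S : {set 'I_L}) : t0 \notin lift t0 @: S.
Proof. by apply/imsetP => -[t _ /eqP]; rewrite (negbTE (neq_lift _ _)). Qed.

Lemma card_add_lift (S : {set 'I_L}) : #|add_lift S| = #|S|.+1.
Proof. by rewrite cardsU1 notin_lift card_imset //; apply: lift_inj. Qed.

Lemma mem_add_lift (S : {set 'I_L}) t : (lift t0 t \in add_lift S) = (t \in S).
Proof.
by rewrite !inE eq_sym (negbTE (neq_lift _ _)) mem_imset //; apply: lift_inj.
Qed.

Lemma Spred_add_lift (S : {set 'I_L}) a :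
  Spred S a = Spred (add_lift S) (bump t0 a).
Proof.
have [lt_a|ge_a] := ltnP a L; last first.
  by rewrite !Spred_ge // /bump; case: leqP (ltn_ord t0) => //= ? ?; lia.
rewrite (mem_Spred S (Ordinal lt_a)) -(mem_add_lift S).
exact/esym/(mem_Spred _ (lift t0 (Ordinal lt_a))).
Qed.

(** [add_lift] is a bijection onto the states containing [t0], with the preimage under [lift t0] as
    inverse. *)
Lemma sum_add_lift (V : nmodType) (Q : pred {set 'I_L.+1}) F :
  \sum_(S : {set 'I_L.+1} | Q S && (t0 \in S)) F S =
  \sum_(S : {set 'I_L} | Q (add_lift S)) F (add_lift S) :> V.
Proof.
rewrite (reindex_onto add_lift (fun S => lift t0 @^-1: S)) => [|S /andP[_ t0S]].
  apply: eq_bigl => S; rewrite setU11 andbT.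
  rewrite (_ : _ @^-1: _ = S) ?eqxx ?andbT //.
  by apply/setP => t; rewrite inE mem_add_lift.
apply/setP => t; case: (unliftP t0 t) => [t'|] ->; last by rewrite setU11.
by rewrite mem_add_lift inE.
Qed.

Lemma prod_add_lift (R : comPzRingType) (S : {set 'I_L}) (F : 'I_L.+1 -> R) :
  \prod_(t in add_lift S) F t = F t0 * \prod_(t in S) F (lift t0 t).
Proof.
rewrite big_setU1 ?notin_lift //=; congr (_ * _).
by rewrite big_imset // => ? ? _ _; apply: lift_inj.
Qed.
End AddElement.

(** * The skein relation *)

Lemma nth_insert (T : Type) (x0 x : T) s1 s2 a :
  nth x0 (s1 ++ x :: s2) (bump (size s1) a) = nth x0 (s1 ++ s2) a.
Proof.
rewrite !nth_cat /bump; case: (leqP (size s1) a) => [le_a|lt_a]; last first.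
  by rewrite -[(_ + a)%N]/a lt_a.
by rewrite -[(_ + a)%N]/a.+1 ltnNge leqW //= subSn.
Qed.

Unset Implicit Arguments.

Theorem theorem3p2 (m : nat) (u v : seq letter) (i k j n : nat) :
  (0 < m)%N ->
  all (fun l : letter => (0 < l.1 < m)%N) u ->
  all (fun l : letter => (0 < l.1 < m)%N) v ->
  (0 < i < m)%N ->
  (1 <= k)%N -> (1 <= j <= k)%N ->
  Dnkj n%:Z k j m (u ++ (i, true) :: v) - Dnkj n%:Z k j m (u ++ (i, false) :: v)
  = Dnkj (n%:Z - 1) k j m (u ++ v).
Proof.
move=> _ uP vP im _ _.
have uv : valid m (u ++ v) by rewrite /valid all_cat uP.
set L := size (u ++ v).
have lt_u : (size u < L.+1)%N by rewrite /L size_cat ltnS leq_addr.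
pose t0 := Ordinal lt_u.
rewrite !(Dnkj_size _ _ _ _ (size_word u v i _)) -/L /Dnkj -sumrB.
apply: eq_bigr => J _; rewrite -sumrB; apply: eq_bigr => col _.
rewrite (bigID (fun S : {set 'I_L.+1} => t0 \in S)) /=.
rewrite [X in _ - X](bigID (fun S : {set 'I_L.+1} => t0 \in S)) /=.
(* States without the new letter have the same conditions and signs in both words. *)
rewrite opprD addrACA [X in _ + X](_ : _ = 0) ?addr0; last first.
  apply/eqP; rewrite subr_eq0; apply/eqP; apply: eq_big => S.
    case: (boolP (t0 \in S)) => [_|t0S]; rewrite ?andbF // !andbT.
    by rewrite good_state_notin // (mem_Spred S t0).
  move=> /andP[_ t0S]; apply: eq_bigr => t tS.
  case: (unliftP t0 t) => [t'|] e; last by rewrite -e tS in t0S.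
  by rewrite e -[nat_of_ord _]/(bump (size u) t') !nth_insert.
rewrite !sum_add_lift !(big_mkcond (fun S => _ && _)) -sumrB /=.
apply: eq_bigr => S _; rewrite !prod_add_lift card_add_lift.
have prodE b :
    \prod_(t in S) sgnl (nth (0%N, true) (u ++ (i, b) :: v) (lift t0 t)) =
    \prod_(t in S) sgnl (nth (0%N, true) (u ++ v) t).
  apply: eq_bigr => t _.
  by rewrite -[nat_of_ord (lift _ _)]/(bump (size u) t) nth_insert.
rewrite !prodE !nth_cat ltnn subnn /= mul1r mulN1r.
(* The new arrow accounts for the shift from [n] to [n - 1]. *)
have cardE : (#|S|.+1%:Z == n%:Z + j%:Z - k%:Z) =
    (#|S|%:Z == n%:Z - 1 + j%:Z - k%:Z).
  by apply/eqP/eqP; lia.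
rewrite cardE; case: eqP => //= _.
have t0S : Spred (add_lift t0 S) (size u) by rewrite (mem_Spred _ t0) setU11.
have := good_state_split uv im t0S (Spred_add_lift t0 S) J col.
(* If the negative crossing is the good one, its sign cancels that of the difference. *)
by do 3!case: (good_state _ _ _) => //=; rewrite ?subr0 ?sub0r ?opprK.
Qed.
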